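(* Let $\mathbf{A}$ be an $n\times n$ real symmetric matrix, let $a\le\lambda_{\min}[\mathbf{A}]$ and $b\ge\lambda_{\max}[\mathbf{A}]$, and let $\mathbf{v}_1,\dots,\mathbf{v}_{n_{\mathrm{v}}}$ be unit vectors. Set $\Psi_i=\Psi[\mathbf{A},\mathbf{v}_i]$ and, for each $i$, let $[\theta_i]_1\le\cdots\le[\theta_i]_k$ be the eigenvalues of the $k\times k$ Lanczos tridiagonal matrix $\mathbf{T}_i$ obtained from $\mathbf{A},\mathbf{v}_i$, and $[d_i]_1,\dots,[d_i]_k$ the squares of the first components of the corresponding normalized eigenvectors, so that $\mathrm{GQ}_k(\Psi_i)(x)=\sum_{j=1}^k[d_i]_j\mathbb{1}[[\theta_i]_j\le x]$. Set $[\theta_i]_0=a$, $[\theta_i]_{k+1}=b$, $[d_i]_0=[d_i]_{k+1}=0$. Writing $\langle x_i\rangle=\frac1{n_{\mathrm{v}}}\sum_{i=1}^{n_{\mathrm{v}}}x_i$, we have $$d_{\mathrm{KS}}\big(\langle\Psi_i\rangle,\langle\mathrm{GQ}_k(\Psi_i)\rangle\big)\le\Big\langle\max_{j=1,\dots,k}[d_i]_j\Big\rangle,$$ $$d_{\mathrm{W}}\big(\langle\Psi_i\rangle,\langle\mathrm{GQ}_k(\Psi_i)\rangle\big)\le\Big\langle\sum_{j=0}^{k}\max\{[d_i]_j,[d_i]_{j+1}\}\big([\theta_i]_{j+1}-[\theta_i]_j\big)\Big\rangle.$$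
   Context: For a symmetric matrix $\mathbf{A}$, $\mathbb{1}[\mathbf{A}\le x]$ is the orthogonal projector onto the span of eigenvectors with eigenvalues $\le x$, and the weighted CESM of a unit vector $\mathbf{v}$ is $\Psi[\mathbf{A},\mathbf{v}](x)=\mathbf{v}^{\mathsf T}\mathbb{1}[\mathbf{A}\le x]\mathbf{v}$. $\mathrm{GQ}_k(\mu)$ denotes the $k$-point Gaussian quadrature rule of a distribution $\mu$: the distribution with $k$ atoms matching the moments of $\mu$ up to degree $2k-1$; for $\mu=\Psi[\mathbf{A},\mathbf{v}]$ it is given by the eigenvalues and squared first eigenvector components of the $k$-step Lanczos tridiagonal matrix as described. $d_{\mathrm{KS}}(\mu,\nu)=\sup_x|\mu(x)-\nu(x)|$ and $d_{\mathrm{W}}(\mu,\nu)=\int|\mu(x)-\nu(x)|\,dx$. *)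

(* Defs.v *)
(* specialised to Stdlib's concrete reals R, which via
   Rstruct is both a realType (MathComp-Analysis) and an rcfType
   (needed for rootsR, the sorted list of real roots of a polynomial). *)
From HB Require Import structures.
From mathcomp Require Import all_boot all_order all_algebra.
From mathcomp Require Import polyrcf.
From mathcomp Require Import classical_sets boolp reals ereal topology normedtype
  sequences measure lebesgue_measure lebesgue_integral.
From Stdlib Require Import Rdefinitions.
From mathcomp Require Import Rstruct Rstruct_topology.

Set Implicit Arguments.
Unset Strict Implicit.
Unset Printing Implicit Defensive.

Import Order.TTheory GRing.Theory Num.Theory.
Local Open Scope ring_scope.

Section Defs.
Variable n : nat.

Definition dotv (u w : 'rV[R]_n) : R := (u *m w^T) ord0 ord0.

Definition orthoproj (S : 'M[R]_n) : 'M[R]_n :=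
  let B := row_base S in B^T *m invmx (B *m B^T) *m B.

(* The span of the eigenvectors of A with eigenvalue <= x: the (row-space) sum
   of the eigenspaces of A over all real eigenvalues lambda <= x (the real
   eigenvalues are exactly the real roots of the characteristic polynomial). *)
Definition low_eigenspan (A : 'M[R]_n) (x : R) : 'M[R]_n :=
  (\sum_(l <- rootsR (char_poly A) | (l <= x)%O) eigenspace A l)%MS.

Definition spec_indicator (A : 'M[R]_n) (x : R) : 'M[R]_n :=
  orthoproj (low_eigenspan A x).

Definition CESM (A : 'M[R]_n) (v : 'rV[R]_n) (x : R) : R :=
  (v *m spec_indicator A x *m v^T) ord0 ord0.

(* state after j steps: (q_{j-1}, q_j, beta_{j-1}) (1-indexed q's, q_0 = 0). *)
Definition lanczos_step (A : 'M[R]_n) (s : 'rV[R]_n * 'rV[R]_n * R) :=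
  let: (qp, qc, bp) := s in
  let w := qc *m A - bp *: qp in
  let a := dotv w qc in
  let w' := w - a *: qc in
  let b := Num.sqrt (dotv w' w') in
  (qc, b^-1 *: w', b).

Fixpoint lanczos_state (A : 'M[R]_n) (v : 'rV[R]_n) (j : nat) :=
  match j with
  | 0 => (0, v, 0)
  | j'.+1 => lanczos_step A (lanczos_state A v j')
  end.

(* alpha_j (0-indexed: diagonal entry j of T) *)
Definition lanczos_alpha (A : 'M[R]_n) (v : 'rV[R]_n) (j : nat) : R :=
  let: (qp, qc, bp) := lanczos_state A v j in dotv (qc *m A - bp *: qp) qc.

(* beta_j (0-indexed: off-diagonal entry (j, j+1) of T) *)
Definition lanczos_beta (A : 'M[R]_n) (v : 'rV[R]_n) (j : nat) : R :=
  (lanczos_state A v j.+1).2.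

Definition lanczos_T (A : 'M[R]_n) (v : 'rV[R]_n) (k : nat) : 'M[R]_k :=
  \matrix_(i < k, l < k)
    if i == l then lanczos_alpha A v i
    else if l == i.+1 :> nat then lanczos_beta A v i
    else if i == l.+1 :> nat then lanczos_beta A v l
    else 0.

Definition lanczos_no_breakdown (A : 'M[R]_n) (v : 'rV[R]_n) (k : nat) :=
  forall j : nat, (j.+1 < k)%nat -> lanczos_beta A v j != 0.

End Defs.

Definition atomic_cdf (k : nat) (th d : 'rV[R]_k) (x : R) : R :=
  \sum_(j < k) d ord0 j * ((th ord0 j <= x)%O)%:R.

Definition ext_theta (k : nat) (a b : R) (th : 'rV[R]_k) (j : nat) : R :=
  nth b (a :: [seq th ord0 l | l <- enum 'I_k]) j.
Definition ext_weight (k : nat) (d : 'rV[R]_k) (j : nat) : R :=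
  nth 0 (0 :: [seq d ord0 l | l <- enum 'I_k]) j.

Definition avg (nv : nat) (x : 'I_nv -> R) : R := (nv%:R)^-1 * \sum_(i < nv) x i.

Definition d_KS (F G : R -> R) : \bar R :=
  ereal_sup (range (fun x => (`|F x - G x|)%:E)).
Definition d_W (F G : R -> R) : \bar R :=
  (\int[@lebesgue_measure R]_x (`|F x - G x|)%:E)%E.

(* Main.v *)
Require Import Defs.
From HB Require Import structures.
From mathcomp Require Import all_boot all_order all_algebra.
From mathcomp Require Import polyrcf complex spectral mxred sesquilinear.
From mathcomp Require Import classical_sets boolp reals ereal topology normedtype
  sequences measure lebesgue_measure lebesgue_integral numfun measurable_realfun.
From Stdlib Require Import Rdefinitions.
From mathcomp Require Import Rstruct Rstruct_topology.
From mathcomp Require Import ring lra zify.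
Import Order.TTheory GRing.Theory Num.Theory.
Local Open Scope ring_scope.

(** For one vector, let Psi be its weighted CESM, GQ the Gauss rule with nodes
    t_1 <= .. <= t_k and weights d_j, and H := Psi - GQ.  By the Lanczos
    relation the two measures share their moments of degree < 2k, so integration
    by parts shows that H is orthogonal to every polynomial of degree <= 2k - 2.
    Between two nodes H is nondecreasing, so it changes sign at most once there,
    and at most once at each node.  If one of the Chebyshev-Markov-Stieltjes
    inequalities d_1 + .. + d_(j-1) <= Psi(x) <= d_1 + .. + d_(j+1), for x in
    [t_j, t_(j+1)[, failed, two of these 2k - 1 possible sign changes would be
    lost, and a nonzero polynomial of degree <= 2k - 3 with the sign of H would
    contradict orthogonality.  Hence |H| <= max(d_j, d_(j+1)) on [t_j, t_(j+1)[,
    and both bounds follow by taking the supremum, resp. integrating. *)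

(** * Step functions orthogonal to polynomials *)

(** Nodes may repeat and weights may be negative, so the difference of two such functions is again
    one, over the sum of the index types. *)
Definition step_fun {R : numDomainType} (I : finType) (z c : I -> R) (x : R) : R :=
  \sum_i c i * (z i <= x)%O%:R.

Definition primitive {R : fieldType} (q : {poly R}) : {poly R} :=
  \poly_(i < (size q).+1) (q`_i.-1 / i%:R).

Lemma deriv_primitive (R : numFieldType) (q : {poly R}) : (primitive q)^`() = q.
Proof.
apply/polyP => i; rewrite coef_deriv coef_poly ltnS /=.
case: ltnP => hi; last by rewrite mul0rn nth_default.
by rewrite -[LHS]mulr_natr mulfVK // pnatr_eq0.
Qed.

(** Supplies a point left of all atoms, where a step function is 0, and one right of all atoms,
    where it equals its total mass. *)
Lemma family_within_dist (R : realDomainType) (I : finType) (z : I -> R) (x : R) :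
  exists2 B, 0 <= B & forall i, x - B < z i < x + B.
Proof.
have sum_ge0 (P : pred I) : 0 <= \sum_(i | P i) `|z i - x|.
  by apply: sumr_ge0 => i _; exact: normr_ge0.
exists (1 + \sum_i `|z i - x|) => [|i]; first by rewrite addr_ge0.
rewrite -ltr_distl (bigD1 i) //= ltr_pwDl // lerDl; exact: sum_ge0.
Qed.

(* Phi below is the integral of q * H from -oo to x; it is nondecreasing, and the
   vanishing moments make it 0 to the right of all atoms, hence everywhere. *)
Lemma step_fun_sign_eq0 (R : rcfType) (I : finType) (z c : I -> R) (q : {poly R}) :
  (forall r, (r <= size q)%nat -> \sum_i c i * z i ^+ r = 0) ->
  (forall x, (forall i, z i != x) -> 0 <= q.[x] * step_fun I z c x) ->
  q != 0 -> forall x, step_fun I z c x = 0.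
Proof.
move=> mom sgn q0.
pose P := primitive q; pose H := step_fun I z c.
have P' : P^`() = q by exact: deriv_primitive.
(* [P] has degree at most [size q], which is the order up to which the moments vanish. *)
have annP : \sum_i c i * P.[z i] = 0.
  under eq_bigr do rewrite horner_coef mulr_sumr.
  rewrite exchange_big big1 //= => j _.
  under eq_bigr do rewrite mulrCA.
  rewrite -mulr_sumr mom ?mulr0 //.
  by rewrite -ltnS (leq_trans (ltn_ord j)) // size_poly.
pose Phi x := \sum_i c i * ((P.[x] - P.[z i]) * (z i <= x)%O%:R).
(* An atom at [y] itself may make [H] jump there, but it adds nothing to [Phi], its factor [P.[y] -
   P.[z i]] being 0. *)
have PhiB x y : x <= y -> (forall i, ~~ (x < z i < y)) ->
    Phi y - Phi x = H x * (P.[y] - P.[x]).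
  move=> xy noz; rewrite -sumrB mulr_suml; apply: eq_bigr => i _.
  have [zx|xz] := leP (z i) x; first by rewrite (le_trans zx xy) /=; ring.
  have := noz i; rewrite xz /= -leNgt => yz.
  have [zy|yz'] := leP (z i) y; last by rewrite /= !mulr0 mul0r subr0.
  have -> : z i = y by apply/eqP; rewrite eq_le zy yz.
  by rewrite /= subrr mul0r !mulr0 mul0r subr0.
have Phi_nd x y : x <= y -> Phi x <= Phi y.
  (* Induction on the number of atoms strictly between [x] and [y], splitting the interval at one of
     them. *)
  have [m] := ubnP #|[set i | x < z i < y]|.
  elim: m x y => // m IH x y ltm xy.
  have [/existsP[i /andP[xi iy]]|/existsPn noz] := boolP [exists i, x < z i < y].
    apply: (@le_trans _ _ (Phi (z i))); apply: IH => //; try exact: ltW.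
      rewrite -ltnS (leq_trans _ ltm) // ltnS; apply: proper_card.
      apply/properP; split.
        by apply/fintype.subsetP => j; rewrite !inE => /andP[-> /lt_trans->].
      by exists i; rewrite !inE ?xi ?iy // ltxx andbF.
    rewrite -ltnS (leq_trans _ ltm) // ltnS; apply: proper_card.
    apply/properP; split.
      by apply/fintype.subsetP => j; rewrite !inE => /andP[ij ->]; rewrite (lt_trans xi ij).
    by exists i; rewrite !inE ?xi ?iy // ltxx.
  move: xy; rewrite le_eqVlt => /predU1P[-> //|xy].
  rewrite -subr_ge0 (PhiB _ _ (ltW xy) noz).
  (* The mean value point [e] is interior, hence not an atom, so the sign hypothesis applies to
     it. *)
  have [e + ->] := poly_mvt P xy; rewrite in_itv /= => /andP[xe ey].
  have -> : H x = H e.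
    apply: eq_bigr => i _; congr (_ * _%:R); congr (nat_of_bool _).
    apply/idP/idP => [zx|ze]; first exact: le_trans zx (ltW xe).
    by rewrite leNgt; have := noz i; rewrite (le_lt_trans ze ey) andbT.
  rewrite P' mulrA; apply: mulr_ge0; last by rewrite subr_ge0 ltW.
  rewrite mulrC; apply: sgn => i.
  by apply: contraNneq (noz i) => ->; rewrite xe ey.
have Phi0 x : Phi x = 0.
  have [B B0 Bz] := family_within_dist _ _ z x.
  apply/eqP; rewrite eq_le; apply/andP; split.
    have -> : 0 = Phi (x + B).
      rewrite /Phi; under eq_bigr => i _.
        have /andP[_ /ltW ->] := Bz i.
        rewrite mulr1 mulrBr; over.
      rewrite sumrB annP -mulr_suml.
      have := mom 0%N (leq0n _); under eq_bigr do rewrite expr0 mulr1.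
      by move=> ->; rewrite mul0r subr0.
    by apply: Phi_nd; rewrite lerDl.
  have -> : 0 = Phi (x - B).
    rewrite /Phi big1 // => i _.
    by have /andP[zB _] := Bz i; rewrite leNgt zB !mulr0.
  by apply: Phi_nd; rewrite gerBl.
move=> x; apply/eqP/negP => /negP Hx.
(* Up to the next root [y] of [g] there is neither an atom nor a root of [q]; if [H x] is nonzero,
   [Phi] changes by [H x * q.[e] * (y - x)], which is nonzero. *)
pose g := q * \prod_i ('X - (z i)%:P).
have g0 : g != 0.
  by rewrite mulf_neq0 //; apply/prodf_neq0 => i _; rewrite polyXsubC_eq0.
pose y := next_root g x (x + 1).
have xy : x < y by apply: next_root_gt => //; rewrite ltrDl.
have nog u : x < u -> u < y -> ~~ root g u.
  by move=> xu uy; have := @next_noroot _ g x (x + 1) u; rewrite in_itv /= xu uy; apply.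
have noz i : ~~ (x < z i < y).
  apply/negP => /andP[xz zy]; have /negP := nog _ xz zy; apply.
  by rewrite rootM (bigD1 i) //= rootM root_XsubC eqxx orbT.
have := PhiB x y (ltW xy) noz.
have [e + ->] := poly_mvt P xy; rewrite in_itv /= => /andP[xe ey].
rewrite !Phi0 subr0 P' => /esym/eqP; rewrite !mulf_eq0 (negbTE Hx) /=.
rewrite subr_eq0 (gt_eqF xy) orbF => /eqP qe.
by have := nog _ xe ey; rewrite rootM negb_or /root qe eqxx.
Qed.

(** * The Chebyshev-Markov-Stieltjes inequalities *)

Section Quadrature.
Variables (R : realType) (k : nat) (t d : nat -> R).
Hypothesis t_sorted : forall i j, (i <= j < k)%nat -> t i <= t j.
Hypothesis d_ge0 : forall j, (j < k)%nat -> 0 <= d j.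

Let S m := \sum_(j < m) d j.
Let G x := \sum_(j < k) d j * (t j <= x)%O%:R.

Lemma quadrature_cdf_le (m : nat) (x : R) : (m < k)%nat -> x < t m -> G x <= S m.
Proof.
move=> mk xt; rewrite /G /S -(big_mkord predT d).
rewrite -(big_mkord predT (fun j => d j * (t j <= x)%O%:R))
  (@big_cat_nat _ _ _ m) ?(ltnW mk) //=.
rewrite [X in _ + X]big_nat_cond [X in _ + X]big1 ?addr0 => [|j].
  apply: ler_sum_nat => j /andP[_ jm].
  have dj := d_ge0 j (ltn_trans jm mk).
  by case: (t j <= x)%O; rewrite /= ?mulr1 ?mulr0.
move=> /andP[/andP[mj jk] _].
have tm : t m <= t j by apply: t_sorted; rewrite mj.
by rewrite leNgt (lt_le_trans xt tm) mulr0.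
Qed.

Lemma quadrature_cdf_ge (m : nat) (x : R) : (m < k)%nat -> t m <= x -> S m.+1 <= G x.
Proof.
move=> mk tx; rewrite /G /S -(big_mkord predT d).
rewrite -(big_mkord predT (fun j => d j * (t j <= x)%O%:R))
  [leRHS](@big_cat_nat _ _ _ m.+1) //=.
apply: ler_wpDr.
  rewrite big_nat_cond sumr_ge0 // => j /andP[/andP[_ jk] _].
  by rewrite mulr_ge0 // d_ge0.
apply: ler_sum_nat => j /andP[_ jm].
have -> : t j <= x by apply: le_trans tx; apply: t_sorted; rewrite -ltnS jm.
by rewrite mulr1.
Qed.

Lemma quadrature_cdf_eq (m : nat) (x : R) :
  (m.+1 < k)%nat -> t m <= x -> x < t m.+1 -> G x = S m.+1.
Proof.
move=> mk tx xt; apply/eqP; rewrite eq_le quadrature_cdf_le //.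
by rewrite quadrature_cdf_ge // ltnW.
Qed.

Variables (I : finType) (lam w : I -> R).
Let Psi := step_fun I lam w.
Hypothesis k_gt0 : (0 < k)%nat.
Hypothesis Psi_nd : {homo Psi : x y / x <= y}.
Hypothesis moments : forall r, (r < k.*2)%nat ->
  \sum_i w i * lam i ^+ r = \sum_(j < k) d j * t j ^+ r.

Let H x := Psi x - G x.

Lemma step_fun_ge0 x : 0 <= Psi x.
Proof.
have [B B0 Bz] := family_within_dist _ _ lam x.
have -> : 0 = Psi (x - B).
  rewrite /Psi /step_fun big1 // => i _.
  by have /andP[zB _] := Bz i; rewrite leNgt zB mulr0.
by apply: Psi_nd; rewrite gerBl.
Qed.

Lemma step_fun_le_mass x : Psi x <= S k.
Proof.
have [B B0 Bz] := family_within_dist _ _ lam x.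
have -> : S k = Psi (x + B).
  have := moments 0; rewrite double_gt0 k_gt0 => /(_ isT).
  under eq_bigr do rewrite expr0 mulr1.
  under [in RHS]eq_bigr do rewrite expr0 mulr1.
  rewrite /S => <-; apply: eq_bigr => i _.
  by have /andP[_ /ltW ->] := Bz i; rewrite mulr1.
by apply: Psi_nd; rewrite lerDl.
Qed.

(** On [t_m, t_(m+1)[ the function [G] is constant, so [H] is nondecreasing and crosses zero upwards
    at most once. An endpoint serves as crossing point when [H] keeps one sign, and the value of [H]
    at [s] itself is left free. *)
Let sign_point m s := [/\ t m <= s <= t m.+1,
  forall x, t m <= x -> x < s -> H x <= 0 &
  forall x, s < x -> x < t m.+1 -> 0 <= H x].

Lemma sign_point_exists m : (m.+1 < k)%nat -> exists s, sign_point m s.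
Proof.
move=> mk; have tm : t m <= t m.+1 by apply: t_sorted; rewrite leqnSn.
pose E : set R := fun x => t m <= x <= t m.+1 /\
  forall y, t m <= y -> y < x -> H y <= 0.
have Em : E (t m).
  by split=> [|y ty yt]; [rewrite lexx tm|move: (le_lt_trans ty yt); rewrite ltxx].
have ubE : ubound E (t m.+1) by move=> y [/andP[]].
have supE : has_sup E by split; [exists (t m)|exists (t m.+1)].
exists (sup E); split=> [|x tx xs|x sx xt].
- by rewrite ub_le_sup //= ?ge_sup //; [exists (t m)|exists (t m.+1)].
- have [y [_ Ey] xy] := sup_gt supE.1 xs.
  exact: Ey.
have tsE : t m <= sup E by rewrite ub_le_sup //; exists (t m.+1).
(* By monotonicity, [H x < 0] would force [H <= 0] on all of [t_m, x[ and put [x] beyond the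
   supremum into [E]. *)
have nEx : ~ E x by move=> /(ub_le_sup (ex_intro _ _ ubE)); rewrite leNgt sx.
apply: contrapT => /negP; rewrite -ltNge => Hx; apply: nEx.
split=> [|y ty yx]; first by rewrite (le_trans tsE (ltW sx)) ltW.
apply: (le_trans _ (ltW Hx)); rewrite /H (quadrature_cdf_eq m) ?(quadrature_cdf_eq m x) //.
- by rewrite lerD2r Psi_nd // ltW.
- exact: le_trans tsE (ltW sx).
- exact: lt_trans yx xt.
Qed.

Lemma sign_points : exists s : nat -> R, forall m, (m.+1 < k)%nat -> sign_point m (s m).
Proof.
have ex m : exists s, (m.+1 < k)%nat -> sign_point m s.
  by case: (ltnP m.+1 k) => [/sign_point_exists[s]|_]; [exists s|exists 0].
by have [s sP] := choice ex; exists s.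
Qed.

(* q = - prod (X - t_j) prod (X - s_j) has the sign of H everywhere; a double
   root at an atom can be divided out without changing signs off the atoms, and
   the quotient then has small enough degree for the matched moments. *)
Lemma sign_point_at_atom (s : nat -> R) (m i : nat) :
  (forall j, (j.+1 < k)%nat -> sign_point j (s j)) ->
  (m.+1 < k)%nat -> (i < k)%nat -> s m = t i -> forall x, Psi x = G x.
Proof.
move=> sP mk ik smi x.
have mk' : (m < k.-1)%nat by lia.
pose o := Ordinal ik; pose o' := Ordinal mk'.
(* The two factors belonging to the common root [t i = s m] are dropped, which leaves degree (k - 1)
   + (k - 2) = 2k - 3. *)
pose q := - \prod_(j < k | j != o) ('X - (t j)%:P)
          * \prod_(j < k.-1 | j != o') ('X - (s j)%:P).
have size_lin (K : nat) (a : 'I_K) (u : nat -> R) :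
    size (\prod_(j < K | j != a) ('X - (u j)%:P)) = K.
  rewrite (eq_bigl (mem (predC1 a))) // -big_enum /= size_prod_XsubC -cardE.
  by rewrite cardC1 card_ord prednK // (leq_ltn_trans _ (ltn_ord a)).
have q0 : q != 0.
  by rewrite mulf_neq0 ?oppr_eq0 // -size_poly_gt0 size_lin //; lia.
have sq : (size q <= k.*2 - 2)%nat.
  move: q0; rewrite mulf_eq0 negb_or => /andP[q1 q2].
  by rewrite size_mul // size_polyN !size_lin; lia.
pose z (a : I + 'I_k) := match a with inl b => lam b | inr j => t j end.
pose c (a : I + 'I_k) := match a with inl b => w b | inr j => - d j end.
have HE y : step_fun _ z c y = H y.
  rewrite /step_fun big_sumType /= /H; congr (_ + _).
  by rewrite -sumrN; apply: eq_bigr => j _; rewrite mulNr.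
suff: step_fun _ z c x = 0 by rewrite HE => /eqP; rewrite subr_eq0 => /eqP.
apply: (@step_fun_sign_eq0 _ _ z c q) => // [r rq|y noz].
  rewrite big_sumType /= moments; last by apply: (leq_ltn_trans (leq_trans rq sq)); lia.
  by under [X in _ + X]eq_bigr do rewrite mulNr; rewrite sumrN subrr.
have yi : t i != y by have := noz (inr o).
rewrite HE.
(* Since [y] is not an atom, multiplying by this positive square restores the full product without
   changing the sign. *)
have y2 : 0 < (y - t i) ^+ 2 by rewrite exprn_even_gt0 //= subr_eq0 eq_sym.
rewrite -(pmulr_rge0 _ y2).
have qE : q.[y] = - \prod_(j < k | j != o) (y - t j)
                  * \prod_(j < k.-1 | j != o') (y - s j).
  rewrite hornerM hornerN !horner_prod.
  by congr (- _ * _); apply: eq_bigr => j _; rewrite hornerXsubC.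
suff : 0 <= - \prod_(j < k) (y - t j) * \prod_(j < k.-1) (y - s j) * H y.
  rewrite (bigD1 o) //= (bigD1 o') //= smi qE.
  by congr (0 <= _); ring.
rewrite (_ : \prod_(j < k) _ = \prod_(j < k.-1) (y - t j) * (y - t k.-1)); last first.
  by case: (k) k_gt0 => // k' _; rewrite big_ord_recr.
(* The pair of [y - t j] and [y - s j] is negative only strictly between [t j] and [s j]; the last
   node gives the one unpaired factor. *)
rewrite (_ : _ * H y = (t k.-1 - y) * H y * \prod_(j < k.-1) ((y - t j) * (y - s j))).
  have tl l : (l < k)%nat -> t l <= t k.-1 by move=> lk; apply: t_sorted; lia.
  (* Right of the last node [G] has reached the total mass, so [H y <= 0] matches the sign of
     [t k.-1 - y]. *)
  have [ty|yt] := leP (t k.-1) y.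
    have Hy : H y <= 0.
      rewrite subr_le0 (le_trans (step_fun_le_mass y)) //.
      by have := quadrature_cdf_ge k.-1 y; rewrite prednK // => ->.
    apply: mulr_ge0; first by rewrite mulr_le0 // subr_le0.
    apply: prodr_ge0 => j _; have jk : (j.+1 < k)%nat by have := ltn_ord j; lia.
    have [/andP[_ st] _ _] := sP j jk.
    by rewrite mulr_ge0 // subr_ge0 (le_trans _ ty) ?tl ?(le_trans st) ?tl //; lia.
  rewrite -mulrA pmulr_rge0 ?subr_gt0 //.
  (* If [y] lies in some [t_j, s_j], that pair alone can be negative and [H y <= 0] compensates it;
     at [y = s j] the product is 0. *)
  have [/existsP[j /andP[tj ys]]|/existsPn none] :=
      boolP [exists j : 'I_k.-1, t j <= y <= s j].
    have jk : (j.+1 < k)%nat by have := ltn_ord j; lia.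
    have [/andP[ts st] Hneg _] := sP j jk.
    rewrite (bigD1 j) //=.
    move: ys; rewrite le_eqVlt => /predU1P[->|ys]; first by rewrite subrr !(mulr0, mul0r).
    rewrite mulrA mulr_ge0 //.
      rewrite mulr_le0 ?Hneg // mulr_ge0_le0 // ?subr_ge0 // subr_le0 ltW //.
    apply: prodr_ge0 => l lj; have lk : (l.+1 < k)%nat by have := ltn_ord l; lia.
    have [/andP[ts' st'] _ _] := sP l lk.
    case: (ltngtP l j) => [ltl|ltj|/val_inj eqlj]; last by rewrite eqlj eqxx in lj.
      have tlj : t l.+1 <= t j by apply: t_sorted; lia.
      by rewrite mulr_ge0 // subr_ge0; lra.
    have tjl : t j.+1 <= t l by apply: t_sorted; lia.
    by rewrite mulr_le0 // subr_le0; lra.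
  (* Otherwise all pairs are nonnegative, and so is [H y]: either [y] precedes every node, or it
     lies in some ]s_j, t_(j+1)[. *)
  apply: mulr_ge0; last first.
    apply: prodr_ge0 => j _; have jk : (j.+1 < k)%nat by have := ltn_ord j; lia.
    have [/andP[ts st] _ _] := sP j jk.
    have [tj|tj] := leP (t j) y; last by rewrite mulr_le0 // subr_le0; lra.
    have := none j; rewrite tj /= -ltNge => sy.
    by rewrite mulr_ge0 // subr_ge0; lra.
  have [t0|t0] := ltP y (t 0).
    rewrite subr_ge0 (le_trans (quadrature_cdf_le 0 y k_gt0 t0)) //.
    by rewrite /S big_ord0 step_fun_ge0.
  have [j jk /andP[tj tj1]] : exists2 j, (j < k.-1)%nat & t j <= y < t j.+1.
    elim: (k.-1) yt => [|l IH] yt; first by move: t0; rewrite leNgt yt.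
    have [tly|tly] := leP (t l) y; first by exists l; rewrite ?tly.
    by have [j jl jP] := IH tly; exists j => //; lia.
  have jk' : (j.+1 < k)%nat by lia.
  have [_ _ Hpos] := sP j jk'; apply: Hpos => //.
  by have := none (Ordinal jk); rewrite tj /= -ltNge.
rewrite big_split /=; ring.
Qed.

(** A violation at [x] persists to the right by monotonicity, so [H >= 0] on all of [t_m, t_(m+1)[
    and the node [t m] itself is a sign point. Then [Psi = G], which is incompatible with the
    violation. For the last node the bound is the total mass. *)
Lemma step_fun_le_psum (m : nat) (x : R) : (m < k)%nat -> x < t m -> Psi x <= S m.+1.
Proof.
move=> mk xt; have [mk'|km] := ltnP m.+1 k; last first.
  by have -> : m.+1 = k; [lia|exact: step_fun_le_mass].
rewrite leNgt; apply/negP => viol.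
have [s0 s0P] := sign_points.
pose s j := if j == m then t m else s0 j.
have Gx : G x <= S m.+1.
  by rewrite (le_trans (quadrature_cdf_le m x mk xt)) // /S big_ord_recr /= lerDl d_ge0.
suff : Psi x = G x by lra.
apply: (sign_point_at_atom s m m) => // [j jk|]; last by rewrite /s eqxx.
rewrite /s; case: eqP => [->|_]; last exact: s0P.
split=> [|y ty yt|y ty yt]; first by rewrite lexx t_sorted // leqnSn.
  by move: (le_lt_trans ty yt); rewrite ltxx.
rewrite /H (quadrature_cdf_eq m) ?(ltW ty) // subr_ge0 (le_trans (ltW viol)) //.
by apply: Psi_nd; rewrite ltW // (lt_trans xt).
Qed.

(** Mirror image: a violation persists to the left, so on the interval that ends at the node in
    question [H <= 0], and its right endpoint is a sign point. *)
Lemma step_fun_ge_psum (m : nat) (x : R) : (m < k)%nat -> t m <= x -> S m <= Psi x.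
Proof.
case: m => [|m] mk tx; first by rewrite /S big_ord0 step_fun_ge0.
rewrite leNgt; apply/negP => viol.
have [s0 s0P] := sign_points.
pose s j := if j == m then t m.+1 else s0 j.
have Gx : S m.+1 <= G x.
  rewrite (le_trans _ (quadrature_cdf_ge m.+1 x mk tx)) //.
  by rewrite /S [leRHS]big_ord_recr /= lerDl d_ge0.
suff : Psi x = G x by lra.
apply: (sign_point_at_atom s m m.+1) => // [j jk|]; last by rewrite /s eqxx.
rewrite /s; case: eqP => [->|_]; last exact: s0P.
split=> [|y ty yt|y ty yt]; first by rewrite lexx t_sorted // leqnSn.
  rewrite /H (quadrature_cdf_eq m) // subr_le0 (le_trans _ (ltW viol)) //.
  by apply: Psi_nd; rewrite ltW // (lt_le_trans yt).
by move: (lt_trans ty yt); rewrite ltxx.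
Qed.


End Quadrature.

(** * Spectral calculus of a real symmetric matrix *)

(** Over the complex numbers the matrix is hermitian, hence unitarily similar to a real diagonal
    matrix; real matrices that are similar over the complex numbers are similar over the reals. The
    resulting [S] is invertible but need not be orthogonal. *)
Lemma symmetric_diagonalizable (R : rcfType) (n : nat) (A : 'M[R]_n) : A^T = A ->
  exists (S : 'M[R]_n) (l : 'rV[R]_n), S \in unitmx /\ S *m A = diag_mx l *m S.
Proof.
move=> symA; pose toC := real_complex R.
pose Ac := map_mx toC A.
have Acreal : Ac \is a realmx.
  by apply/mxOverP => i j; rewrite mxE complex_real.
have Acherm : Ac \is hermsymmx.
  apply: realsym_hermsym => //; apply/is_hermitianmxP.
  by apply/matrixP => i j; rewrite expr0 scale1r !mxE -[in LHS]symA mxE.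
have Dreal := hermitian_spectral_diag_real Acherm.
have /orthomx_spectralP eqA := hermitian_normalmx Acherm.
have [|||S /andP[Sreal Sunit] simS] :=
    @real_similar _ _ Ac (diag_mx (spectral_diag Ac)).
- exists (spectralmx Ac); first exact: spectral_unit.
  apply/similarP; first exact: spectral_unit.
  by rewrite {2}eqA !mulmxA mulmxV ?spectral_unit // mul1mx.
- by [].
- by rewrite mxOver_diag ?rpred0.
pose Sr := map_mx (@complex.Re R) S; pose l := map_mx (@complex.Re R) (spectral_diag Ac).
have SE : S = map_mx toC Sr.
  by apply/matrixP => i j; rewrite !mxE /toC RRe_real //; apply: (mxOverP Sreal).
have lE : spectral_diag Ac = map_mx toC l.
  by apply/matrixP => i j; rewrite !mxE /toC RRe_real //; apply: (mxOverP Dreal).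
exists Sr, l; split; first by move: Sunit; rewrite SE map_unitmx.
move/(similarP Sunit): simS; rewrite SE lE -map_diag_mx -!map_mxM.
exact: map_mx_inj.
Qed.

Lemma quad_form_sqr_ge0 (R : realDomainType) (n : nat) (u : 'rV[R]_n) :
  0 <= (u *m u^T) ord0 ord0.
Proof. by rewrite mxE sumr_ge0 // => j _; rewrite mxE -expr2 sqr_ge0. Qed.

Lemma quad_form_sqr_eq0 (R : realDomainType) (n : nat) (u : 'rV[R]_n) :
  (u *m u^T) ord0 ord0 = 0 -> u = 0.
Proof.
rewrite mxE => /eqP; rewrite psumr_eq0 => [/allP u0|j _]; last first.
  by rewrite mxE -expr2 sqr_ge0.
apply/rowP => j; have /implyP := u0 j (mem_index_enum _).
by rewrite mxE -expr2 sqrf_eq0 mxE => /(_ isT)/eqP.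
Qed.

Section FunctionalCalculus.
Variables (R : rcfType) (n : nat) (A S : 'M[R]_n) (l : 'rV[R]_n).
Hypotheses (symA : A^T = A) (Sunit : S \in unitmx) (SA : S *m A = diag_mx l *m S).

(** This is f(A); the rows of [S] are the eigenvectors. *)
Definition fcalc (f : R -> R) : 'M[R]_n := invmx S *m diag_mx (map_mx f l) *m S.

(* The Gram matrix S S^T of the eigenbasis only links equal eigenvalues. *)
Lemma gram_diag_comm (f : R -> R) :
  diag_mx (map_mx f l) *m (S *m S^T) = S *m S^T *m diag_mx (map_mx f l).
Proof.
(* The left side is S A S^T, which is symmetric; transposing it yields the right side. *)
have comm : diag_mx l *m (S *m S^T) = S *m S^T *m diag_mx l.
  have e : diag_mx l *m (S *m S^T) = S *m A *m S^T by rewrite mulmxA -SA.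
  rewrite e; have := congr1 trmx e; rewrite !trmx_mul !trmxK symA tr_diag_mx => ->.
  by rewrite mulmxA.
move: (S *m S^T) comm => G comm; apply/matrixP => i j.
have /matrixP/(_ i j) := comm; rewrite !mul_diag_mx !mul_mx_diag !mxE.
have [->|Gij] := eqVneq (G i j) 0; first by rewrite !(mulr0, mul0r).
by rewrite mulrC => /(mulfI Gij) ->; rewrite mulrC.
Qed.

(** For a non-orthogonal [S], symmetry of f(A) amounts to f(D) commuting with the Gram matrix S
    S^T. *)
Lemma trmx_fcalc f : (fcalc f)^T = fcalc f.
Proof.
rewrite /fcalc !trmx_mul tr_diag_mx mulmxA trmx_inv.
have STu : S^T \in unitmx by rewrite unitmx_tr.
apply: (canLR (mulmxK STu)); rewrite -!mulmxA.
apply: (canRL (mulKmx Sunit)).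
by rewrite gram_diag_comm mulmxA.
Qed.

Lemma fcalcM f g : fcalc f *m fcalc g = fcalc (fun x => f x * g x).
Proof.
rewrite /fcalc !mulmxA mulmxK //; congr (_ *m _); rewrite -mulmxA; congr (_ *m _).
by apply/matrixP => i j; rewrite mul_diag_mx !mxE mulrnAr.
Qed.

Lemma fcalcB f g : fcalc f - fcalc g = fcalc (fun x => f x - g x).
Proof.
rewrite /fcalc -mulmxBl -mulmxBr; congr (_ *m _ *m _).
by apply/matrixP => i j; rewrite !mxE mulrnBl.
Qed.

Lemma eq_fcalc f g : (forall j, f (l ord0 j) = g (l ord0 j)) -> fcalc f = fcalc g.
Proof.
by move=> fg; congr (_ *m diag_mx _ *m _); apply/rowP => j; rewrite !mxE fg.
Qed.

Lemma fcalc1 : fcalc (fun=> 1) = 1%:M.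
Proof.
rewrite /fcalc (_ : map_mx _ _ = const_mx 1) ?diag_const_mx ?mulmx1 ?mulVmx //.
by apply/rowP => j; rewrite !mxE.
Qed.

Lemma fcalc_id : fcalc id = A.
Proof. by rewrite /fcalc map_mx_id // -mulmxA -SA mulKmx. Qed.

Lemma fcalcX r : fcalc (fun x => x ^+ r) = A ^+ r.
Proof.
elim: r => [|r IH].
  by rewrite expr0 -[RHS]/(1%:M) -fcalc1; apply: eq_fcalc => j; rewrite expr0.
rewrite exprS -IH -[X in X * _]fcalc_id -[RHS]/(_ *m _) fcalcM.
by apply: eq_fcalc => j; rewrite exprS.
Qed.

(** With g the square root of f, f(A) = g(A) g(A)^T, so the form is a squared norm. *)
Lemma fcalc_ge0 (v : 'rV[R]_n) f : (forall j, 0 <= f (l ord0 j)) ->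
  0 <= (v *m fcalc f *m v^T) ord0 ord0.
Proof.
move=> f0; pose g x := Num.sqrt (f x).
have -> : fcalc f = fcalc g *m (fcalc g)^T.
  by rewrite trmx_fcalc fcalcM; apply: eq_fcalc => j; rewrite -expr2 sqr_sqrtr.
by rewrite (mulmxA v) -[_ *m v^T]mulmxA -trmx_mul; exact: quad_form_sqr_ge0.
Qed.

Lemma fcalc_le (v : 'rV[R]_n) f g : (forall j, f (l ord0 j) <= g (l ord0 j)) ->
  (v *m fcalc f *m v^T) ord0 ord0 <= (v *m fcalc g *m v^T) ord0 ord0.
Proof.
move=> fg; rewrite -subr_ge0.
suff -> : (v *m fcalc g *m v^T) ord0 ord0 - (v *m fcalc f *m v^T) ord0 ord0 =
    (v *m fcalc (fun x => g x - f x) *m v^T) ord0 ord0.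
  by apply: fcalc_ge0 => j; rewrite subr_ge0.
by rewrite -fcalcB mulmxBr mulmxBl [RHS]mxE [X in _ = _ + X]mxE.
Qed.

Lemma fcalc_sum (v : 'rV[R]_n) f :
  (v *m fcalc f *m v^T) ord0 ord0 =
  \sum_j ((v *m invmx S) ord0 j * (S *m v^T) j ord0) * f (l ord0 j).
Proof.
rewrite /fcalc !mulmxA -mulmxA mxE; apply: eq_bigr => j _.
by rewrite mul_mx_diag !mxE; ring.
Qed.

Lemma diag_eigenvalue j : eigenvalue A (l ord0 j).
Proof.
apply/eigenvalueP; exists (row j S).
  by rewrite -row_mul SA row_mul row_diag_mx -scalemxAl -rowE.
apply: contraTneq Sunit => S0; apply/negP => Su.
have := mulmxV Su => /(congr1 (row j)); rewrite row_mul S0 mul0mx => /rowP/(_ j).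
by rewrite !mxE eqxx => /eqP; rewrite eq_sym oner_eq0.
Qed.

End FunctionalCalculus.

(** Equal row spaces give MP = M and PM = P for the Gram formula M; as both matrices are symmetric,
    transposing identifies them. *)
Lemma orthoproj_unique (n : nat) (V P : 'M[R]_n) :
  P^T = P -> P *m P = P -> (V :=: P)%MS -> orthoproj V = P.
Proof.
move=> symP idP eqVP; rewrite /orthoproj.
move: (row_base V) (row_base_free V) (eq_row_base V) => B Bfree BV.
set M := _ *m B.
have BBu : B *m B^T \in unitmx.
  rewrite -row_free_unit -kermx_eq0; apply/rowV0P => u /sub_kermxP uB.
  have : ((u *m B) *m (u *m B)^T) ord0 ord0 = 0.
    by rewrite trmx_mul mulmxA -(mulmxA u) uB mul0mx mxE.
  by move/quad_form_sqr_eq0/eqP; rewrite mulmx_free_eq0 // => /eqP.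
have /submxP[X BX] : (B <= P)%MS by rewrite BV eqVP.
have /submxP[Y PY] : (P <= B)%MS by rewrite BV eqVP.
have BP : B *m P = B by rewrite BX -mulmxA idP.
have MP : M *m P = M by rewrite /M -mulmxA BP.
have PM : P *m M = P.
  have -> : P *m M = Y *m (B *m B^T *m invmx (B *m B^T)) *m B.
    by rewrite [in LHS]PY /M !mulmxA.
  by rewrite mulmxV // mulmx1 -PY.
have symM : M^T = M.
  by rewrite /M !trmx_mul trmxK trmx_inv trmx_mul trmxK mulmxA.
by rewrite -MP -symM -symP -trmx_mul PM.
Qed.

(** * Spectral projectors and the CESM as a step function *)

Section SpectralMeasure.
Variables (n : nat) (A S : 'M[R]_n) (l : 'rV[R]_n).
Hypotheses (symA : A^T = A) (Sunit : S \in unitmx) (SA : S *m A = diag_mx l *m S).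

Lemma spec_indicator_fcalc x :
  spec_indicator A x = fcalc R n S l (fun y => (y <= x)%O%:R).
Proof.
apply: orthoproj_unique; first exact: (trmx_fcalc _ _ _ _ _ symA Sunit SA).
  rewrite fcalcM //; apply: eq_fcalc => j.
  by case: (l ord0 j <= x)%O; rewrite /= ?mulr1 ?mulr0.
apply/eqmxP/andP; split.
  rewrite /low_eigenspan; elim/big_rec: _ => [|r V rx]; first exact: sub0mx.
  rewrite addsmx_sub => ->; rewrite andbT.
  have /eigenspaceP := submx_refl (eigenspace A r).
  move: (eigenspace A r) => E EA.
  have [W WS] : exists W, E = W *m S by exists (E *m invmx S); rewrite mulmxKV.
  (* In eigenbasis coordinates, [E] is supported on the indices with eigenvalue [r], where the
     indicator is 1. *)
  have Wl : W *m diag_mx l = r *: W.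
    apply: (can_inj (mulmxK Sunit)).
    by rewrite -mulmxA -SA mulmxA -WS EA -scalemxAl -WS.
  suff -> : E = E *m fcalc R n S l (fun y => (y <= x)%O%:R) by exact: submxMl.
  rewrite /fcalc !mulmxA WS mulmxK //; congr (_ *m _).
  apply/matrixP => i j; rewrite mul_mx_diag !mxE.
  have /matrixP/(_ i j) := Wl; rewrite mul_mx_diag !mxE mulrC.
  have [->|Wij] := eqVneq (W i j) 0; first by rewrite mul0r.
  by move=> /(mulIf Wij) lj; rewrite lj rx mulr1.
apply: (submx_trans (_ : _ <= diag_mx (map_mx (fun y => (y <= x)%O%:R) l) *m S)%MS).
  by rewrite /fcalc -mulmxA submxMl.
apply/row_subP => j; rewrite row_mul row_diag_mx -scalemxAl -rowE mxE.
have [lx|_] := leP (l ord0 j) x; last by rewrite scale0r sub0mx.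
rewrite scale1r.
have lroot : l ord0 j \in rootsR (char_poly A).
  rewrite -roots_on_rootsR ?monic_neq0 ?char_poly_monic // in_itv /=.
  by rewrite -eigenvalue_root_char; exact: (diag_eigenvalue _ _ _ _ _ Sunit SA).
rewrite /low_eigenspan (big_rem _ lroot) /= lx; apply: submx_trans (addsmxSl _ _).
by apply/eigenspaceP; rewrite -row_mul SA row_mul row_diag_mx -scalemxAl -rowE.
Qed.

(* Individual weights may be negative, since S need not be orthogonal; only their
   sums over eigenspaces matter. *)
Definition spec_weight (v : 'rV[R]_n) (j : 'I_n) : R :=
  (v *m invmx S) ord0 j * (S *m v^T) j ord0.

Lemma CESM_step_fun (v : 'rV[R]_n) (x : R) :
  CESM A v x = step_fun _ (fun j => l ord0 j) (spec_weight v) x.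
Proof. by rewrite /CESM spec_indicator_fcalc fcalc_sum. Qed.

Lemma CESM_nondecreasing (v : 'rV[R]_n) (x y : R) :
  (x <= y)%O -> (CESM A v x <= CESM A v y)%O.
Proof.
move=> xy; rewrite /CESM !spec_indicator_fcalc.
apply: (fcalc_le _ _ _ _ _ symA Sunit SA) => j.
by rewrite ler_nat; case: (leP _ x) => // /le_trans->.
Qed.

Lemma spec_weight_moment (v : 'rV[R]_n) (r : nat) :
  \sum_j spec_weight v j * l ord0 j ^+ r = (v *m A ^+ r *m v^T) ord0 ord0.
Proof. by rewrite -(fcalcX _ _ _ _ _ Sunit SA) fcalc_sum. Qed.

(** The identity function is compared on the spectrum with the constants [a] and [b]. *)
Lemma rayleigh_bounds (a b : R) (y : 'rV[R]_n) :
  (forall j, (a <= l ord0 j)%O /\ (l ord0 j <= b)%O) -> dotv y y = 1 ->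
  (a <= (y *m A *m y^T) ord0 ord0)%O /\ ((y *m A *m y^T) ord0 ord0 <= b)%O.
Proof.
move=> lab y1.
have cst c : (y *m fcalc R n S l (fun=> c) *m y^T) ord0 ord0 = c.
  rewrite (_ : fcalc _ _ _ _ _ = c%:M).
    by rewrite mul_mx_scalar -scalemxAl mxE -/(dotv y y) y1 mulr1.
  rewrite /fcalc (_ : map_mx _ _ = const_mx c); last by apply/rowP => j; rewrite !mxE.
  by rewrite diag_const_mx mul_mx_scalar -scalemxAl mulVmx // scalemx1.
rewrite -[A](fcalc_id _ _ _ _ _ Sunit SA) -{1}(cst a) -[X in _ /\ (_ <= X)%O](cst b).
by split; apply: (fcalc_le _ _ _ _ _ symA Sunit SA) => j; have [] := lab j.
Qed.

End SpectralMeasure.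

(** * The Lanczos recurrence *)

Section DotProduct.
Variable n : nat.
Implicit Types u w z : 'rV[R]_n.

Lemma dotvC u w : dotv u w = dotv w u.
Proof. by rewrite /dotv -[u *m _]trmxK trmx_mul trmxK mxE. Qed.

Lemma dotvDl u w z : dotv (u + w) z = dotv u z + dotv w z.
Proof. by rewrite /dotv mulmxDl mxE. Qed.

Lemma dotvBl u w z : dotv (u - w) z = dotv u z - dotv w z.
Proof. by rewrite /dotv mulmxBl mxE [X in _ + X]mxE. Qed.

Lemma dotvZl (c : R) u w : dotv (c *: u) w = c * dotv u w.
Proof. by rewrite /dotv -scalemxAl mxE. Qed.

Lemma dotv0l u : dotv 0 u = 0.
Proof. by rewrite /dotv mul0mx mxE. Qed.

Lemma dotv_ge0 u : (0 <= dotv u u)%O.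
Proof. exact: quad_form_sqr_ge0. Qed.

Lemma dotv_sym (A : 'M[R]_n) u w : A^T = A -> dotv (u *m A) w = dotv (w *m A) u.
Proof. by move=> symA; rewrite [RHS]dotvC /dotv trmx_mul symA mulmxA. Qed.

End DotProduct.

Lemma sum_eq_ord (V : lmodType R) (k m : nat) (F : nat -> V) :
  \sum_(j < k) (j == m :> nat)%:R *: F j = if (m < k)%nat then F m else 0.
Proof.
case: ltnP => mk; last first.
  by rewrite big1 // => j _; rewrite ltn_eqF ?scale0r // (leq_trans (ltn_ord j)).
rewrite (bigD1 (Ordinal mk)) //= eqxx scale1r big1 ?addr0 // => j.
by rewrite -val_eqE /= => /negbTE ->; rewrite scale0r.
Qed.

Section Lanczos.
Variables (n : nat) (A : 'M[R]_n) (v : 'rV[R]_n) (k : nat).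
Hypotheses (symA : A^T = A) (v1 : dotv v v = 1) (nobreak : lanczos_no_breakdown A v k).

Let st := lanczos_state A v.
Let q j := (st j).1.2.
Let al := lanczos_alpha A v.
Let be := lanczos_beta A v.
(** Here [(st j).1.1] is q_(j-1) and [(st j).2] is beta_(j-1), both 0 for j = 0. *)
Let wres j := q j *m A - (st j).2 *: (st j).1.1.
Let res j := wres j - al j *: q j.

Lemma lanczos_stateS j : st j.+1 = (q j, (be j)^-1 *: res j, be j).
Proof.
rewrite /res /wres /q /be /al /lanczos_beta /lanczos_alpha /st /=.
by case: (lanczos_state A v j) => [[qp qc] bp].
Qed.

Lemma lanczos_betaE j : be j = Num.sqrt (dotv (res j) (res j)).
Proof.
rewrite /res /wres /q /be /al /lanczos_beta /lanczos_alpha /st /=.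
by case: (lanczos_state A v j) => [[qp qc] bp].
Qed.

Lemma lanczos_alphaE j : al j = dotv (wres j) (q j).
Proof.
rewrite /wres /q /al /lanczos_alpha /st /=.
by case: (lanczos_state A v j) => [[qp qc] bp].
Qed.

Lemma lanczos_recurrence j : (j.+1 < k)%nat ->
  q j *m A = (st j).2 *: (st j).1.1 + al j *: q j + be j *: q j.+1.
Proof.
move=> jk; rewrite [q j.+1]/q lanczos_stateS /= scalerA divff; last exact: nobreak.
by rewrite scale1r /res /wres [X in _ = X + _]addrC -addrA addrCA !subrKC.
Qed.

Let orthonormal j := forall i l, (i <= j)%nat -> (l <= j)%nat ->
  dotv (q i) (q l) = (i == l)%:R.

(** Against q_j this is the choice of alpha_j. For i < j, symmetry moves [A] onto q_i, whose
    recurrence meets q_j only if i = j - 1; that contribution cancels the subtracted beta_(j-1)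
    q_(j-1). *)
Lemma lanczos_residual_orthogonal j : (j < k)%nat -> orthonormal j ->
  forall i, (i <= j)%nat -> dotv (res j) (q i) = 0.
Proof.
move=> jk on i; rewrite leq_eqVlt => /predU1P[->|ij].
  by rewrite dotvBl dotvZl on // eqxx mulr1 -lanczos_alphaE subrr.
rewrite /res /wres !dotvBl !dotvZl (on j i) // ?(ltnW ij) // gtn_eqF // mulr0 subr0.
rewrite dotv_sym // lanczos_recurrence; last exact: leq_ltn_trans ij jk.
rewrite !dotvDl !dotvZl (on i j) ?(ltnW ij) // ltn_eqF // mulr0 addr0.
rewrite (on i.+1 j) //.
have -> : dotv (st i).1.1 (q j) = 0.
  case: i ij => [|i] ij; first by rewrite dotv0l.
  by rewrite lanczos_stateS /= on ?ltn_eqF //; lia.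
rewrite mulr0 add0r; case: j => // j in jk on ij *.
rewrite lanczos_stateS /= (on j i) ?(ltnW ij) // eqSS eq_sym.
by case: eqP => [->|_]; rewrite ?mulr0 subrr.
Qed.

Lemma lanczos_orthonormal j : (j < k)%nat -> orthonormal j.
Proof.
elim: j => [|j IH] jk; first by move=> [|i] [|l].
have {IH} on := IH (ltnW jk).
have qS : q j.+1 = (be j)^-1 *: res j by rewrite /q lanczos_stateS.
have qqS : dotv (q j.+1) (q j.+1) = 1.
  rewrite qS dotvZl dotvC dotvZl mulrA -expr2 exprVn lanczos_betaE sqr_sqrtr ?dotv_ge0 //.
  rewrite mulVf //; have := nobreak j jk; apply: contraNneq => e.
  by rewrite -/(be j) lanczos_betaE e sqrtr0.
have qSi i : (i <= j)%nat -> dotv (q j.+1) (q i) = 0.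
  by move=> ij; rewrite qS dotvZl lanczos_residual_orthogonal ?mulr0 // ltnW.
move=> i l; rewrite leq_eqVlt => /predU1P[->|ij]; rewrite leq_eqVlt => /predU1P[->|lj].
- by rewrite qqS eqxx.
- by rewrite qSi // gtn_eqF.
- by rewrite dotvC qSi // ltn_eqF.
- exact: on.
Qed.

Let T := lanczos_T A v k.
Definition lanczos_basis : 'M[R]_(k, n) := \matrix_(i < k) q i.
Let Q := lanczos_basis.
(** The last residual stays unnormalised, since [lanczos_no_breakdown] allows it to vanish. *)
Let E : 'M[R]_(k, n) := \matrix_(i < k) if i.+1 == k then res i else 0.

Lemma lanczos_basis_orthonormal : Q *m Q^T = 1%:M.
Proof.
apply/matrixP => i j; rewrite -[LHS]/((Q *m Q^T) i j).
have -> : (Q *m Q^T) i j = dotv (q i) (q j).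
  by rewrite /dotv !mxE; apply: eq_bigr => l _; rewrite !mxE.
rewrite (lanczos_orthonormal (maxn i j)) ?leq_maxl ?leq_maxr ?mxE //.
by rewrite gtn_max !ltn_ord.
Qed.

Lemma trmx_lanczos_T : T^T = T.
Proof.
apply/matrixP => i j; rewrite !mxE eq_sym.
by case: eqVneq => [->|_] //; case: eqP; case: eqP => // -> /eqP; lia.
Qed.

Lemma lanczos_T_entry (i j : 'I_k) : T i j =
  al i * (j == i :> nat)%:R + be i * (j == i.+1 :> nat)%:R +
  (st i).2 * (j.+1 == i :> nat)%:R.
Proof.
rewrite mxE -[i == j]val_eqE /= [j == i :> nat]eq_sym.
case: (ltngtP i j) => ij /=.
- rewrite (_ : (i == j.+1 :> nat) = false); last by apply/eqP; lia.
  rewrite (_ : (j.+1 == i :> nat) = false); last by apply/eqP; lia.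
  by case: eqP => _; rewrite !(mulr0, mulr1, addr0, add0r).
- rewrite (_ : (j == i.+1 :> nat) = false); last by apply/eqP; lia.
  rewrite [j.+1 == i :> nat]eq_sym.
  by case: eqP => [->|_]; rewrite !(mulr0, mulr1, addr0, add0r).
- rewrite (_ : (j == i.+1 :> nat) = false); last by apply/eqP; lia.
  rewrite (_ : (j.+1 == i :> nat) = false); last by apply/eqP; lia.
  by rewrite !(mulr0, mulr1, addr0).
Qed.

(** Row by row this is the three-term recurrence; in the last row the next basis vector falls
    outside [Q], and [E] supplies the residual instead. *)
Lemma lanczos_relation : Q *m A = T *m Q + E.
Proof.
apply/row_matrixP => i; rewrite row_mul linearD /= !rowK row_mul [X in _ = X + _]mulmx_sum_row.
have -> : \sum_j row i T ord0 j *: row j Q =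
    al i *: q i + (if (i.+1 < k)%nat then be i *: q i.+1 else 0) +
    (st i).2 *: (st i).1.1.
  under eq_bigr => j _ do rewrite mxE lanczos_T_entry rowK !scalerDl -!scalerA.
  rewrite !big_split /= -!scaler_sumr !sum_eq_ord ltn_ord; congr (_ + _ + _).
    by case: ifP; rewrite ?scaler0.
  case: (nat_of_ord i) (ltn_ord i) => [|m] mk; first by rewrite !scale0r.
  rewrite (_ : \sum__ _ = \sum_(j < k) (j == m :> nat)%:R *: q j) //.
  by rewrite sum_eq_ord (ltnW mk) lanczos_stateS.
case: eqP => ik; last first.
  have ik' : (i.+1 < k)%nat by have := ltn_ord i; lia.
  by rewrite ik' addr0 lanczos_recurrence // [RHS]addrC addrA.
rewrite ik ltnn addr0 /res /wres addrACA addrC [X in X + _]addrC.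
by rewrite addrACA; apply/eqP; rewrite -subr_eq0; apply/eqP/rowP => c; rewrite !mxE; ring.
Qed.

Lemma lanczos_compression : Q *m A *m Q^T = T.
Proof.
rewrite lanczos_relation mulmxDl -mulmxA lanczos_basis_orthonormal mulmx1.
rewrite (_ : E *m Q^T = 0) ?addr0 //; apply/matrixP => i j.
have -> : (E *m Q^T) i j = dotv (row i E) (q j).
  by rewrite /dotv !mxE; apply: eq_bigr => l _; rewrite !mxE.
rewrite rowK [RHS]mxE; case: eqP => ik; last exact: dotv0l.
apply: lanczos_residual_orthogonal; first exact: ltn_ord.
  exact/lanczos_orthonormal/ltn_ord.
by have := ltn_ord j; lia.
Qed.

Hypothesis k_gt0 : (0 < k)%nat.
Let e0 : 'rV[R]_k := delta_mx ord0 (Ordinal k_gt0).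

(** Each factor of the tridiagonal [T] enlarges the support by at most one index. *)
Lemma lanczos_T_band r (j : 'I_k) : (r < j)%nat -> (e0 *m T ^+ r) ord0 j = 0.
Proof.
elim: r j => [|r IH] j rj.
  by rewrite expr0 mulmx1 mxE eqxx -val_eqE /= gtn_eqF.
rewrite exprSr -[T ^+ r * T]/(T ^+ r *m T) mulmxA mxE big1 // => l _.
have [rl|lr] := ltnP r l; first by rewrite IH // mul0r.
by rewrite lanczos_T_entry !gtn_eqF ?mulr0 ?addr0 ?mulr0 //; lia.
Qed.

(** Below power k the vector e0 T^(r-1) has not reached the last coordinate, so the error [E] never
    enters. *)
Lemma lanczos_krylov r : (r < k)%nat -> v *m A ^+ r = e0 *m T ^+ r *m Q.
Proof.
elim: r => [|r IH] rk.
  by rewrite !expr0 !mulmx1 -rowE rowK.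
rewrite !exprSr -[A ^+ r * A]/(A ^+ r *m A) mulmxA IH ?(ltnW rk) //.
rewrite -mulmxA lanczos_relation mulmxDr (mulmxA _ T) -(mulmxA e0 _ T).
rewrite (_ : _ *m E = 0) ?addr0 //.
rewrite mulmx_sum_row big1 // => j _; rewrite rowK.
case: eqP => jk; last by rewrite scaler0.
by rewrite lanczos_T_band ?scale0r //; lia.
Qed.

(** A positive power is split as i + 1 + j with i, j < k: the Krylov identity handles both outer
    factors and the compression Q A Q^T = T the middle one. This reaches degree 2k - 1. *)
Lemma lanczos_moments r : (r < k.*2)%nat ->
  (v *m A ^+ r *m v^T) ord0 ord0 = (e0 *m T ^+ r *m e0^T) ord0 ord0.
Proof.
have v0 := lanczos_krylov 0 k_gt0; rewrite !expr0 !mulmx1 in v0.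
case: r => [|r] rk.
  rewrite !expr0 !mulmx1 -/(dotv v v) v1 trmx_delta mul_delta_mx mxE eqxx.
  by [].
pose i := (r./2)%nat; pose j := (r - i)%nat.
have ik : (i < k)%nat by rewrite /i; lia.
have jk : (j < k)%nat by rewrite /j /i; lia.
have rE : r = (i + j)%nat by rewrite /j /i; lia.
have powT (m p : nat) (B : 'M[R]_m) : B^T = B -> (B ^+ p)^T = B ^+ p.
  move=> symB; elim: p => [|p IH]; first by rewrite !expr0 trmx1.
  by rewrite [in LHS]exprSr -[LHS]/((B ^+ p *m B)^T) trmx_mul IH symB exprS.
have split_pow (m : nat) (B : 'M[R]_m) (u : 'rV[R]_m) : B^T = B ->
    u *m B ^+ r.+1 *m u^T = (u *m B ^+ i) *m B *m (u *m B ^+ j)^T.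
  move=> symB; rewrite trmx_mul powT // rE -addSn exprD exprSr.
  by rewrite -[_ * _ * _]/(_ *m _ *m _) !mulmxA.
rewrite !split_pow ?trmx_lanczos_T //.
rewrite !lanczos_krylov // [in LHS]trmx_mul !mulmxA.
rewrite -(mulmxA _ Q A) -(mulmxA _ _ Q^T) lanczos_compression.
by [].
Qed.

Variables (U : 'M[R]_k) (th : 'rV[R]_k).
Hypotheses (Uorth : U^T *m U = 1%:M) (TU : T *m U = U *m diag_mx th).

Lemma ritz_moments r : (e0 *m T ^+ r *m e0^T) ord0 ord0 =
  \sum_(j < k) U (Ordinal k_gt0) j ^+ 2 * th ord0 j ^+ r.
Proof.
have UU : U *m U^T = 1%:M by apply: mulmx1C.
have TrU : T ^+ r *m U = U *m diag_mx (map_mx (fun x => x ^+ r) th).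
  elim: r => [|r IH].
    rewrite expr0 mul1mx (_ : map_mx _ _ = const_mx 1) ?diag_const_mx ?mulmx1 //.
    by apply/rowP => j; rewrite !mxE expr0.
  rewrite exprSr -[T ^+ r * T]/(T ^+ r *m T) -mulmxA TU mulmxA IH -mulmxA.
  congr (_ *m _).
  by apply/matrixP => i j; rewrite mul_diag_mx !mxE exprSr mulrnAr.
rewrite -[e0^T]mul1mx -UU (_ : _ *m _ =
    (e0 *m U *m diag_mx (map_mx (fun x => x ^+ r) th)) *m (e0 *m U)^T).
  rewrite mxE; apply: eq_bigr => j _.
  by rewrite -rowE mul_mx_diag !mxE expr2; ring.
by rewrite trmx_mul !mulmxA -[in RHS](mulmxA e0) -TrU !mulmxA.
Qed.

(** Lifting an eigenvector of [T] through [Q] makes the node a Rayleigh quotient of [A], which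
    confines it to [a, b]. *)
Lemma ritz_vector j : exists y : 'rV[R]_n,
  dotv y y = 1 /\ (y *m A *m y^T) ord0 ord0 = th ord0 j.
Proof.
pose u := row j U^T; exists (u *m Q).
have uu : u *m u^T = 1%:M.
  apply/matrixP => a b; rewrite !ord1.
  have /matrixP/(_ j j) := Uorth; rewrite !mxE !eqxx => <-.
  by apply: eq_bigr => l _; rewrite !mxE.
split.
  by rewrite /dotv trmx_mul !mulmxA -(mulmxA u) lanczos_basis_orthonormal mulmx1 uu mxE.
rewrite trmx_mul !mulmxA -(mulmxA u) -(mulmxA u) lanczos_compression.
rewrite /u tr_row trmxK -mulmxA colE (mulmxA T) TU.
rewrite rowE -!mulmxA (mulmxA U^T) Uorth mul1mx.
rewrite (_ : diag_mx th *m _ = th ord0 j *: delta_mx j ord0).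
  by rewrite -scalemxAr mul_delta_mx !mxE mulr1.
by apply/matrixP => a b; rewrite mul_diag_mx !mxE; case: eqP => [->|]; rewrite ?mulr0.
Qed.

End Lanczos.

(** * Averaging and integration *)

Lemma indic_itvco (p q x : R) :
  ((p <= x < q)%O%:R : R) = \1_(`[p, q[%classic) x.
Proof. by rewrite indicE mem_setE in_itv. Qed.

Lemma measurable_itv_steps (J : finType) (c p q : J -> R) :
  @measurable_fun _ _ (measurableTypeR R) (measurableTypeR R) setT
    (fun x => \sum_j c j * (p j <= x < q j)%O%:R).
Proof.
apply: measurable_sum => j; apply: measurable_funM => //.
under eq_fun do rewrite indic_itvco.
by apply: measurable_indic; exact: measurable_itv.
Qed.

Lemma integral_itv_steps (J : finType) (c p q : J -> R) :
  (forall j, (0 <= c j)%O) -> (forall j, (p j <= q j)%O) ->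
  (\int[@lebesgue_measure R]_x (\sum_j c j * (p j <= x < q j)%O%:R)%:E =
   (\sum_j c j * (q j - p j))%:E)%E.
Proof.
move=> c0 pq.
under eq_integral do rewrite -sumEFin.
have mitv j : measurable (`[p j, q j[%classic : set (measurableTypeR R)) by exact: measurable_itv.
have muE j : lebesgue_measure (`[p j, q j[%classic : set (measurableTypeR R)) =
    (q j - p j)%:E.
  rewrite lebesgue_measure_itv /= lte_fin; case: ifPn => [_|]; first by rewrite EFinB.
  by rewrite -leNgt => qp; rewrite (@le_anti _ _ (p j) (q j)) ?subrr // pq qp.
rewrite ge0_integral_sum //=.
- rewrite -sumEFin; apply: eq_bigr => j _.
  under eq_integral do rewrite EFinM indic_itvco.
  rewrite ge0_integralZl_EFin //=; last first.
  + exact/measurable_EFinP/measurable_indic.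
  rewrite integral_indic // setIT.
  by rewrite EFinM -muE.
- move=> j; apply/measurable_EFinP; apply: measurable_funM => //.
  by under eq_fun do rewrite indic_itvco; exact: measurable_indic.
- by move=> j x _; rewrite lee_fin mulr_ge0.
Qed.

Section Average.
Variable nv : nat.
Implicit Types x y : 'I_nv -> R.

Lemma avg_sum x : avg x = \sum_i nv%:R^-1 * x i.
Proof. exact: mulr_sumr. Qed.

Lemma avg_le x y : (forall i, (x i <= y i)%O) -> (avg x <= avg y)%O.
Proof. by move=> xy; rewrite ler_wpM2l ?invr_ge0 ?ler0n // ler_sum. Qed.

Lemma avgB x y : avg x - avg y = avg (fun i => x i - y i).
Proof. by rewrite /avg -mulrBr sumrB. Qed.

Lemma ler_norm_avg x : (`|avg x| <= avg (fun i => `|x i|))%O.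
Proof.
rewrite normrM ger0_norm ?invr_ge0 ?ler0n //.
by rewrite ler_wpM2l ?invr_ge0 ?ler0n // ler_norm_sum.
Qed.

End Average.

Section ExtendedNodes.
Variables (k : nat) (a b : R) (th d : 'rV[R]_k).

Lemma ext_theta_ord (j : 'I_k) : ext_theta a b th j.+1 = th ord0 j.
Proof. by rewrite /ext_theta /= (nth_map j) ?size_enum_ord // nth_ord_enum. Qed.

Lemma ext_theta_default j : (k < j)%nat -> ext_theta a b th j = b.
Proof.
by case: j => // j kj; rewrite /ext_theta /= nth_default // size_map size_enum_ord.
Qed.

Lemma ext_weight_ord (j : 'I_k) : ext_weight d j.+1 = d ord0 j.
Proof. by rewrite /ext_weight /= (nth_map j) ?size_enum_ord // nth_ord_enum. Qed.

Lemma ext_weight_default j : (k < j)%nat -> ext_weight d j = 0.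
Proof.
by case: j => // j kj; rewrite /ext_weight /= nth_default // size_map size_enum_ord.
Qed.

End ExtendedNodes.

Lemma atomic_cdf_nondecreasing (k : nat) (th d : 'rV[R]_k) (x y : R) :
  (forall j, (0 <= d ord0 j)%O) -> (x <= y)%O -> (atomic_cdf th d x <= atomic_cdf th d y)%O.
Proof.
move=> d0 xy; apply: ler_sum => j _; rewrite ler_wpM2l // ler_nat.
by case: (leP _ x) => // /le_trans->.
Qed.

(** For sorted nodes, [c] is the number of nodes at or below [x]; each condition is void at its end
    of the range. *)
Lemma locate_node (R : realDomainType) (k : nat) (t : nat -> R) (x : R) :
  exists2 c, (c <= k)%nat &
    (forall m, c = m.+1 -> (t m <= x)%O) /\ ((c < k)%nat -> (x < t c)%O).
Proof.
elim: k => [|k [c ck [lo hi]]]; first by exists 0%nat.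
move: ck; rewrite leq_eqVlt => /predU1P[ck|ck].
  have [tx|xt] := leP (t k) x; last first.
    by exists c; [rewrite ck|split=> //; rewrite ck].
  by exists k.+1 => //; split=> [m [<-]|]; rewrite ?ltnn.
by exists c; [lia|split=> // _; exact: hi].
Qed.

(** * Error of the Gauss rule for one vector *)

Section OneVector.
Variables (n k : nat) (A : 'M[R]_n) (a b : R) (v : 'rV[R]_n) (th : 'rV[R]_k) (U : 'M[R]_k).
Hypotheses (hk : (0 < k)%nat) (symA : A^T = A)
  (Aab : forall l : R, eigenvalue A l -> (a <= l)%O /\ (l <= b)%O)
  (v1 : dotv v v = 1) (nobreak : lanczos_no_breakdown A v k)
  (Uorth : U^T *m U = 1%:M) (TU : lanczos_T A v k *m U = U *m diag_mx th)
  (th_sorted : forall j1 j2 : 'I_k, (j1 <= j2)%nat -> (th ord0 j1 <= th ord0 j2)%O).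

Let d := \row_(j < k) (U (Ordinal hk) j) ^+ 2.
Let err x := `|CESM A v x - atomic_cdf th d x|.

Lemma ritz_bounds j : (a <= th ord0 j)%O /\ (th ord0 j <= b)%O.
Proof.
have [S [l [Su SA]]] := symmetric_diagonalizable _ _ _ symA.
have [y [yy <-]] := ritz_vector _ _ _ _ symA v1 nobreak _ _ Uorth TU j.
apply: (rayleigh_bounds _ _ _ _ symA Su SA) => // i.
exact/Aab/(diag_eigenvalue _ _ _ _ _ Su SA).
Qed.

Lemma ext_weight_ge0 j : (0 <= ext_weight d j)%O.
Proof.
case: j => [|j]; first by rewrite /ext_weight.
have [jk|kj] := ltnP j k; first by rewrite (ext_weight_ord _ _ (Ordinal jk)) mxE sqr_ge0.
by rewrite ext_weight_default.
Qed.

Lemma ext_theta_le j : (j <= k)%nat -> (ext_theta a b th j <= ext_theta a b th j.+1)%O.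
Proof.
move=> jk; have [jk'|kj] := ltnP j k; last first.
  rewrite [leRHS]ext_theta_default //; case: j jk kj => [|j] jk kj; first by lia.
  by rewrite (ext_theta_ord _ _ _ _ (Ordinal jk)); have [] := ritz_bounds (Ordinal jk).
rewrite (ext_theta_ord _ _ _ _ (Ordinal jk')).
case: j jk jk' => [|j] jk jk'; first by have [] := ritz_bounds (Ordinal jk').
rewrite (ext_theta_ord _ _ _ _ (Ordinal jk)); exact: th_sorted.
Qed.

(** Dropping the left endpoint returns to nodes counted from 0, as total functions on the
    naturals. *)
Let t m := ext_theta a b th m.+1.
Let w m := ext_weight d m.+1.
Let S m := \sum_(j < m) w j.

Lemma ext_nodes_sorted i j : (i <= j < k)%nat -> (t i <= t j)%O.
Proof.
move=> /andP[ij jk]; have ik := leq_ltn_trans ij jk.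
rewrite /t (ext_theta_ord _ _ _ _ (Ordinal ik)) (ext_theta_ord _ _ _ _ (Ordinal jk)).
exact: th_sorted.
Qed.

Lemma atomic_cdf_ext x : atomic_cdf th d x = \sum_(j < k) w j * (t j <= x)%O%:R.
Proof.
by apply: eq_bigr => j _; rewrite /w /t ext_theta_ord ext_weight_ord.
Qed.

Lemma CESM_psum_bounds x :
  [/\ (0 <= CESM A v x)%O, (CESM A v x <= S k)%O,
      forall m, (m < k)%nat -> (x < t m)%O -> (CESM A v x <= S m.+1)%O,
      forall m, (m < k)%nat -> (t m <= x)%O -> (S m <= CESM A v x)%O &
      ((x < a)%O -> CESM A v x = 0) /\ ((b <= x)%O -> CESM A v x = S k)].
Proof.
have [V [l [Vu VA]]] := symmetric_diagonalizable _ _ _ symA.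
have lab j : (a <= l ord0 j)%O /\ (l ord0 j <= b)%O.
  exact/Aab/(diag_eigenvalue _ _ _ _ _ Vu VA).
pose W := spec_weight n V v.
have PsiE y : CESM A v y = step_fun _ (fun j => l ord0 j) W y.
  exact: (CESM_step_fun _ _ _ _ symA Vu VA).
have nd y z : (y <= z)%O -> (step_fun _ (fun j => l ord0 j) W y <=
    step_fun _ (fun j => l ord0 j) W z)%O.
  by rewrite -!PsiE; exact: (CESM_nondecreasing _ _ _ _ symA Vu VA).
have mom r : (r < k.*2)%nat ->
    \sum_j W j * l ord0 j ^+ r = \sum_(j < k) w j * t j ^+ r.
  move=> rk; rewrite (spec_weight_moment _ _ _ _ Vu VA).
  rewrite (lanczos_moments _ _ _ _ symA v1 nobreak hk) //.
  rewrite (ritz_moments _ _ _ _ _ _ _ Uorth TU).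
  by apply: eq_bigr => j _; rewrite /w /t ext_theta_ord ext_weight_ord mxE.
have w0 j : (j < k)%nat -> (0 <= w j)%O by move=> _; exact: ext_weight_ge0.
rewrite PsiE; split.
- exact: step_fun_ge0.
- exact: (step_fun_le_mass _ k t).
- move=> m; exact: (step_fun_le_psum _ k t w ext_nodes_sorted w0).
- move=> m; exact: (step_fun_ge_psum _ k t w ext_nodes_sorted w0).
split=> [xa|bx].
  rewrite /step_fun big1 // => j _; rewrite leNgt (lt_le_trans xa) ?mulr0 //.
  by have [] := lab j.
have := mom 0%nat; rewrite double_gt0 hk => /(_ isT).
under eq_bigr do rewrite expr0 mulr1.
under [in RHS]eq_bigr do rewrite expr0 mulr1.
rewrite /S => <-; apply: eq_bigr => j _; rewrite (le_trans _ bx) ?mulr1 //.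
by have [] := lab j.
Qed.

(** With [c] nodes at or below [x], the rule equals S_c, while Psi lies between S_c - d_c and S_c +
    d_(c+1) in the extended numbering. The location of [x] needs the side conditions only at the
    artificial nodes [a] and [b]. *)
Lemma CESM_error_local x : exists2 c, (c <= k)%nat &
  [/\ (err x <= Num.max (ext_weight d c) (ext_weight d c.+1))%O,
      (a <= x)%O -> (ext_theta a b th c <= x)%O &
      (x < b)%O -> (x < ext_theta a b th c.+1)%O].
Proof.
have w0 j : (j < k)%nat -> (0 <= w j)%O by move=> _; exact: ext_weight_ge0.
have [Psi0 PsiS Psi_le Psi_ge _] := CESM_psum_bounds x.
have [c ck [lo hi]] := locate_node R k t x.
have Glo : (S c <= atomic_cdf th d x)%O.
  rewrite atomic_cdf_ext; case: c ck lo hi => [|m] ck lo hi.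
    by rewrite /S big_ord0 sumr_ge0 // => j _; rewrite mulr_ge0 // w0.
  exact: (quadrature_cdf_ge _ k t w ext_nodes_sorted w0 m x ck (lo m erefl)).
have Ghi : (atomic_cdf th d x <= S c)%O.
  rewrite atomic_cdf_ext; move: ck; rewrite leq_eqVlt => /predU1P[->|ck].
    apply: ler_sum => j _; have := w0 j (ltn_ord j).
    by case: (t j <= x)%O; rewrite ?mulr1 ?mulr0.
  exact: (quadrature_cdf_le _ k t w ext_nodes_sorted w0 c x ck (hi ck)).
have GE : atomic_cdf th d x = S c by apply/eqP; rewrite eq_le Glo Ghi.
exists c => //; split.
- have up : (CESM A v x <= S c + ext_weight d c.+1)%O.
    move: (ck); rewrite leq_eqVlt => /predU1P[->|ck'].
      by rewrite (le_trans PsiS) // lerDl ext_weight_ge0.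
    by have := Psi_le c ck' (hi ck'); rewrite /S big_ord_recr.
  have down : (S c - ext_weight d c <= CESM A v x)%O.
    case: c ck lo {hi Glo Ghi GE up} => [|m] ck lo.
      by rewrite /S big_ord0 sub0r (le_trans _ Psi0) // oppr_le0 ext_weight_ge0.
    by rewrite /S big_ord_recr /= addrK Psi_ge // lo.
  have := ext_weight_ge0 c; have := ext_weight_ge0 c.+1.
  rewrite /err GE ler_norml; move: (S c) up down => s up down h1 h2.
  have [m1 m2] : (ext_weight d c <= Num.max (ext_weight d c) (ext_weight d c.+1))%O /\
      (ext_weight d c.+1 <= Num.max (ext_weight d c) (ext_weight d c.+1))%O.
    by rewrite !le_max !lexx orbT.
  by apply/andP; split; lra.
- by case: c ck lo {hi Glo Ghi GE} => // m _ lo _; exact: lo.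
- move: ck; rewrite leq_eqVlt => /predU1P[->|ck]; last by move=> _; exact: hi.
  by rewrite ext_theta_default.
Qed.

Lemma CESM_error_le_max x : (err x <= \big[Num.max/0]_(j < k) d ord0 j)%O.
Proof.
have [c ck [errc _ _]] := CESM_error_local x.
have bound j : (j <= k.+1)%nat -> (ext_weight d j <= \big[Num.max/0]_(j < k) d ord0 j)%O.
  have max0 : (0 <= \big[Num.max/0]_(j < k) d ord0 j)%O by exact: bigmax_ge_id.
  case: j => [|j] jk; first by rewrite /ext_weight.
  have [jk'|kj] := ltnP j k; last first.
    by rewrite ext_weight_default.
  rewrite (ext_weight_ord _ _ (Ordinal jk')).
  exact: (le_bigmax _ (fun j => d ord0 j)).
by rewrite (le_trans errc) // ge_max !bound //; lia.
Qed.

(** Outside [a, b[ both distribution functions are 0 or both equal the total mass; inside, the term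
    of the interval containing [x] already suffices. *)
Lemma CESM_error_le_steps x : (err x <= \sum_(j < k.+1)
  Num.max (ext_weight d j) (ext_weight d j.+1) *
  (ext_theta a b th j <= x < ext_theta a b th j.+1)%O%:R)%O.
Proof.
have terms_ge0 j : (0 <= Num.max (ext_weight d j) (ext_weight d j.+1) *
    (ext_theta a b th j <= x < ext_theta a b th j.+1)%O%:R)%O.
  by rewrite mulr_ge0 // le_max ext_weight_ge0.
have [_ _ _ _ [Psi_lo Psi_hi]] := CESM_psum_bounds x.
have [xa|ax] := ltP x a.
  rewrite /err Psi_lo // atomic_cdf_ext big1 => [|j _].
    by rewrite subrr normr0 sumr_ge0.
  rewrite /t ext_theta_ord leNgt (lt_le_trans xa) ?mulr0 //.
  by have [] := ritz_bounds j.
have [bx|xb] := leP b x.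
  rewrite /err Psi_hi // atomic_cdf_ext (_ : \sum__ _ = S k).
    by rewrite subrr normr0 sumr_ge0.
  apply: eq_bigr => j _; rewrite /t ext_theta_ord (le_trans _ bx) ?mulr1 //.
  by have [] := ritz_bounds j.
have [c ck [errc lo hi]] := CESM_error_local x.
have ck' : (c < k.+1)%nat by [].
rewrite (bigD1 (Ordinal ck')) //= lo // hi // mulr1 (le_trans errc) //.
by rewrite lerDl sumr_ge0.
Qed.

End OneVector.

(** * Averaging over the starting vectors *)

Theorem theorem3 (n nv k : nat) (A : 'M[R]_n) (a b : R)
    (v : 'I_nv -> 'rV[R]_n) (th : 'I_nv -> 'rV[R]_k) (U : 'I_nv -> 'M[R]_k)
    (hk : (0 < k)%nat) :
  A^T = A ->
  (forall l : R, eigenvalue A l -> (a <= l)%O /\ (l <= b)%O) ->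
  (forall i, dotv (v i) (v i) = 1) ->
  (forall i, lanczos_no_breakdown A (v i) k) ->
  (forall i, (U i)^T *m U i = 1%:M) ->
  (forall i, lanczos_T A (v i) k *m U i = U i *m diag_mx (th i)) ->
  (forall i (j1 j2 : 'I_k), (j1 <= j2)%nat -> (th i ord0 j1 <= th i ord0 j2)%O) ->
  let d i := \row_(j < k) (U i (Ordinal hk) j) ^+ 2 in
  let Psi_avg x := avg (fun i => CESM A (v i) x) in
  let GQ_avg x := avg (fun i => atomic_cdf (th i) (d i) x) in
  (d_KS Psi_avg GQ_avg
     <= (avg (fun i => \big[Num.max/0]_(j < k) d i ord0 j))%:E)%E /\
  (d_W Psi_avg GQ_avg
     <= (avg (fun i => \sum_(j < k.+1)
           Num.max (ext_weight (d i) j) (ext_weight (d i) j.+1)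
             * (ext_theta a b (th i) j.+1 - ext_theta a b (th i) j)))%:E)%E.
Proof.
move=> symA Aab v1 nobreak Uorth TU th_sorted d Psi_avg GQ_avg.
have err_avg (B : 'I_nv -> R) x :
    (forall i, (`|CESM A (v i) x - atomic_cdf (th i) (d i) x| <= B i)%O) ->
    (`|Psi_avg x - GQ_avg x| <= avg B)%O.
  by move=> errB; rewrite avgB (le_trans (ler_norm_avg _ _)) // avg_le.
split.
  apply: ge_ereal_sup => _ [x _ <-]; rewrite lee_fin.
  apply: err_avg => i.
  exact: (CESM_error_le_max _ _ _ a b _ _ _ _ symA Aab
    (v1 i) (nobreak i) (Uorth i) (TU i) (th_sorted i)).
pose M i j := Num.max (ext_weight (d i) j) (ext_weight (d i) j.+1).
have M0 i j : (0 <= M i j)%O by rewrite le_max ext_weight_ge0.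
(* Indexing by pairs turns the averaged bound into the integral of a single sum of interval
   steps. *)
pose c (ij : 'I_nv * 'I_k.+1) := nv%:R^-1 * M ij.1 ij.2.
pose lo (ij : 'I_nv * 'I_k.+1) := ext_theta a b (th ij.1) ij.2.
pose hi (ij : 'I_nv * 'I_k.+1) := ext_theta a b (th ij.1) ij.2.+1.
have avg_pair (F : 'I_nv -> nat -> R) :
    avg (fun i => \sum_(j < k.+1) M i j * F i j) = \sum_ij c ij * F ij.1 ij.2.
  rewrite avg_sum; under eq_bigr do rewrite mulr_sumr.
  by rewrite pair_bigA; apply: eq_bigr => ij _; rewrite /c mulrA.
rewrite (avg_pair (fun i j => ext_theta a b (th i) j.+1 - ext_theta a b (th i) j)).
have c0 ij : (0 <= c ij)%O by rewrite mulr_ge0 // invr_ge0 ler0n.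
have lohi ij : (lo ij <= hi ij)%O.
  apply: (ext_theta_le _ _ _ a b _ _ _ hk symA Aab (v1 ij.1) (nobreak ij.1)
    (Uorth ij.1) (TU ij.1) (th_sorted ij.1)).
  by rewrite -ltnS.
rewrite -(integral_itv_steps _ _ _ _ c0 lohi).
apply: ge0_le_integral => //=.
- apply/measurable_EFinP.
  have mB : @measurable_fun _ _ (measurableTypeR R) (measurableTypeR R) setT
      (fun x => Psi_avg x - GQ_avg x); last first.
    exact: measurableT_comp (@normr_measurable R setT) mB.
  (* Both averages are nondecreasing, hence measurable. *)
  apply: measurable_funB; apply: nondecreasing_measurable => // x y xy;
    apply: avg_le => i.
    have [V [l [Vu VA]]] := symmetric_diagonalizable _ _ _ symA.
    exact: (CESM_nondecreasing _ _ _ _ symA Vu VA).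
  by apply: atomic_cdf_nondecreasing => // j; rewrite mxE sqr_ge0.
- by apply/measurable_EFinP; apply: measurable_itv_steps.
- move=> x _; rewrite lee_fin.
  rewrite -(avg_pair (fun i j =>
    (ext_theta a b (th i) j <= x < ext_theta a b (th i) j.+1)%O%:R)).
  apply: err_avg => i.
  exact: (CESM_error_le_steps _ _ _ a b _ _ _ _ symA Aab
    (v1 i) (nobreak i) (Uorth i) (TU i) (th_sorted i)).
Qed.
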